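(* Every graph $H$ is the $\gamma_L$-graph of infinitely many graphs; that is, for every graph $H$ there exist infinitely many graphs $G$ with $G(\gamma_L)\cong H$.
   Context: For a graph $G$, a set $S\subseteq V(G)$ is locating-dominating if it is dominating and the sets $N[v]\cap S$, for $v\in V(G)-S$, are pairwise distinct. $\gamma_L(G)$ is the minimum cardinality of a locating-dominating set, and a $\gamma_L$-set is a locating-dominating set of that cardinality. The $\gamma_L$-graph $G(\gamma_L)$ has one vertex for each $\gamma_L$-set of $G$, and the vertices corresponding to $S_u,S_w$ are adjacent iff there exist $u'\in S_u$, $w'\in S_w$ with $u'w'\in E(G)$ and $S_w=(S_u-\{u'\})\cup\{w'\}$. *)

(* Defs.v *)
From mathcomp Require Import all_boot.

Set Implicit Arguments.
Unset Strict Implicit.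
Unset Printing Implicit Defensive.

(* Finite simple graphs.  As usual the vertex set is nonempty: this matters,
   since every graph has a locating-dominating set, so the null graph is
   never a gamma_L-graph. *)
Record sgraph := SGraph {
  vertex :> finType;
  edge : rel vertex;
  edge_sym : symmetric edge;
  edge_irrefl : irreflexive edge;
  vertex_gt0 : 0 < #|vertex|
}.

Definition graph_iso (G H : sgraph) : Prop :=
  exists f : G -> H, bijective f /\ forall x y, edge (f x) (f y) = edge x y.

Section LocatingDomination.
Variable G : sgraph.
Implicit Types (u v w : G) (S T : {set G}).

Definition closed_nbhd v : {set G} := [set u | (u == v) || edge v u].

Definition dominating S : bool :=
  [forall v, (v \notin S) ==> [exists u in S, edge v u]].

Definition locating S : bool :=
  [forall u in ~: S, forall v in ~: S,
     (u != v) ==> (closed_nbhd u :&: S != closed_nbhd v :&: S)].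

Definition locating_dominating S : bool := dominating S && locating S.

Lemma locating_dominating_setT : locating_dominating [set: G].
Proof.
apply/andP; split; first by apply/forallP => v; rewrite inE.
by apply/forallP => u; rewrite !inE.
Qed.

Definition gammaL : nat :=
  #|[arg min_(S < [set: G] | locating_dominating S) #|S|]|.

Lemma gammaL_min S : locating_dominating S -> gammaL <= #|S|.
Proof.
move=> ldS; rewrite /gammaL.
by case: arg_minnP => [|T _ minT]; [exact: locating_dominating_setT | exact: minT].
Qed.

Lemma gammaL_attained : exists2 S, locating_dominating S & #|S| = gammaL.
Proof.
rewrite /gammaL; case: arg_minnP => [|T ldT _].
  exact: locating_dominating_setT.
by exists T.
Qed.

Definition gammaL_set S : bool := locating_dominating S && (#|S| == gammaL).

Definition gammaL_vertex : predArgType := {S : {set G} | gammaL_set S}.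

Definition gammaL_edge : rel gammaL_vertex := fun S T : gammaL_vertex =>
  [exists u in val S, exists w in val T,
     edge u w && (val T == (val S :\ u) :|: [set w])].

(* The slide relation is symmetric and irreflexive only because its two ends
   have the same cardinality. *)
Lemma gammaL_edge_notin (S T : gammaL_vertex) u w :
  u \in val S -> edge u w -> val T = (val S :\ u) :|: [set w] ->
  w \notin val S.
Proof.
move=> uS euw defT; apply/negP => wS.
have /andP[_ /eqP cS] := valP S; have /andP[_ /eqP cT] := valP T.
have neq_wu : w != u by apply: contraTneq euw => ->; rewrite edge_irrefl.
have TE : val T = val S :\ u.
  by rewrite defT; apply/setUidPl; rewrite sub1set !inE neq_wu.
by have := cardsD1 u (val S); rewrite uS -TE cS cT => /eqP; rewrite eqn_leq ltnn andbF.
Qed.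

Lemma gammaL_edge_sym : symmetric gammaL_edge.
Proof.
suff sub (S T : gammaL_vertex) : gammaL_edge S T -> gammaL_edge T S.
  by move=> S T; apply/idP/idP; apply: sub.
case/existsP => u /andP[uS /existsP[w /andP[wT /andP[euw /eqP defT]]]].
have wNS := gammaL_edge_notin uS euw defT.
apply/existsP; exists w; rewrite wT; apply/existsP; exists u.
rewrite uS edge_sym euw; apply/eqP/setP => x; rewrite defT !inE.
case: (eqVneq x u) => [->|_] /=; first by rewrite uS orbT.
by case: (eqVneq x w) => [->|_] /=; rewrite ?(negPf wNS) ?orbF.
Qed.

Lemma gammaL_edge_irrefl : irreflexive gammaL_edge.
Proof.
move=> S; apply/negbTE/negP.
case/existsP => u /andP[uS /existsP[w /andP[wS /andP[euw /eqP defS]]]].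
by have := gammaL_edge_notin uS euw defS; rewrite wS.
Qed.

Lemma gammaL_vertex_gt0 : 0 < #|gammaL_vertex|.
Proof.
have [S ldS cS] := gammaL_attained.
have gS : gammaL_set S by rewrite /gammaL_set ldS cS eqxx.
by apply/card_gt0P; exists (Sub S gS).
Qed.

Definition gammaL_graph : sgraph :=
  SGraph gammaL_edge_sym gammaL_edge_irrefl gammaL_vertex_gt0.

End LocatingDomination.

(* Main.v *)
Require Import Defs.
From mathcomp Require Import all_boot.

(* In the path P5, the two neighbours of the leaves (the "cores") form the only
   set of at most two vertices that dominates and separates the leaves and the
   middle vertex, and this remains so when further edges are attached to the
   cores.  Take many disjoint P5's together with a copy of H and two pairs of
   "twins".  All vertices outside the paths are joined to cores so that the
   cores dominate everything and separate everything except the twins of each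
   pair.  Only one twin of each pair is joined to H, and it is joined to all of
   H, so a single extra vertex separates both pairs exactly when it lies in H.
   Hence the minimum sets are the cores plus one vertex of H, and a slide
   between two of them is an edge of H.  Adding isolated P5's gives infinitely
   many graphs. *)

Set Implicit Arguments.
Unset Strict Implicit.
Unset Printing Implicit Defensive.

(** A vertex outside [S] adds nothing to its own trace on [S], so closed neighbourhoods can be
    replaced by adjacency. *)
Lemma locating_dominatingP (G : sgraph) (S : {set G}) :
  reflect ((forall v, v \notin S -> exists2 s, s \in S & edge v s) /\
           (forall u v, u \notin S -> v \notin S ->
              (forall s, s \in S -> edge u s = edge v s) -> u = v))
          (locating_dominating S).
Proof.
apply: (iffP andP) => [[/forallP domS /forall_inP locS]|[domS locS]].
  split=> [v vS|u v uS vS eq_uv].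
    by have /implyP/(_ vS)/exists_inP[s] := domS v; exists s.
  have uSC : u \in ~: S by rewrite inE.
  have /forall_inP/(_ v) := locS u uSC.
  rewrite inE vS => /(_ isT)/implyP locuv; apply/eqP; apply/negPn/negP => neq_uv.
  case/negP: (locuv neq_uv); apply/eqP/setP => s; rewrite !inE.
  have [sS|] := boolP (s \in S); last by rewrite !andbF.
  rewrite !andbT eq_uv //.
  by rewrite (negPf (memPn uS s sS)) (negPf (memPn vS s sS)).
split.
  apply/forallP => v; apply/implyP => /domS[s sS evs].
  by apply/exists_inP; exists s.
apply/forall_inP => u; rewrite inE => uS.
apply/forall_inP => v; rewrite inE => vS.
apply/implyP => neq_uv; apply/negP => /eqP eqN; case/eqP: neq_uv.
apply: locS => // s sS; have /setP/(_ s) := eqN.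
by rewrite !inE sS !andbT (negPf (memPn uS s sS)) (negPf (memPn vS s sS)).
Qed.

Lemma graph_iso_card (G H : sgraph) : graph_iso G H -> #|G| = #|H|.
Proof. by case=> f [/bij_eq_card]. Qed.

(* [None] is the middle vertex of the path; [Some (b, false)] and
   [Some (b, true)] are the core and the leaf on side [b]. *)
Definition p5 : finType := option (bool * bool).

Definition p5_edge (p q : p5) : bool :=
  match p, q with
  | None, None => false
  | None, Some (_, l) | Some (_, l), None => ~~ l
  | Some (b, l), Some (c, m) => (b == c) && (l != m)
  end.

Definition core (b : bool) : p5 := Some (b, false).

Lemma big_p5 (F : p5 -> nat) :
  \sum_p F p = F None + (F (Some (true, true)) + F (core true))
                      + (F (Some (false, true)) + F (core false)).
Proof.
rewrite (bigD1 None) //= -addnA; congr (_ + _).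
rewrite (reindex_omap Some id) //=; last by case.
under eq_bigl do rewrite eqxx.
transitivity (\sum_b \sum_l F (Some (b, l))).
  by rewrite pair_bigA; apply: eq_bigr => -[].
by rewrite !big_bool.
Qed.

(** * The graph built from [H] and [n] *)

Section Construction.
Variables (H : sgraph) (n : nat).

Definition label_type : finType := (H + bool + 'I_n)%type.
Definition outer : finType := (H + bool * bool)%type.

(** Both twins of a pair get the same label, so that no core separates them. No outer vertex has a
    label from ['I_n], which leaves those paths isolated. *)
Definition label (o : outer) : label_type :=
  match o with inl v => inl (inl v) | inr (b, _) => inl (inr b) end.

Definition expansion_vertex : finType :=
  (outer + option label_type * p5)%type.

Definition attached (o : outer) (j : option label_type) (p : p5) : bool :=
  (p == core true) && ((j == None) || (j == Some (label o))).

(* [inr (b, false)] and [inr (b, true)] are the twins of the pair [b]. *)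
Definition expansion_edge (x y : expansion_vertex) : bool :=
  match x, y with
  | inl (inl u), inl (inl v) => edge u v
  | inl (inl _), inl (inr (_, c)) | inl (inr (_, c)), inl (inl _) => c
  | inl (inr _), inl (inr _) => false
  | inl o, inr (j, p) | inr (j, p), inl o => attached o j p
  | inr (j, p), inr (k, q) => (j == k) && p5_edge p q
  end.

Lemma expansion_edge_sym : symmetric expansion_edge.
Proof.
move=> [[u|[b c]]|[j p]] [[v|[b' c']]|[k q]] //=; first exact: edge_sym.
rewrite eq_sym; congr (_ && _).
by case: p q => [[b l]|] [[c m]|] //=; rewrite eq_sym [m == l]eq_sym.
Qed.

Lemma expansion_edge_irrefl : irreflexive expansion_edge.
Proof.
move=> [[u|[b c]]|[j p]] //=; first exact: edge_irrefl.
by rewrite eqxx; case: p => [[b l]|] //=; rewrite !eqxx.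
Qed.

Lemma expansion_vertex_gt0 : 0 < #|expansion_vertex|.
Proof. by apply/card_gt0P; exists (inr (None, None)). Qed.

Definition expansion : sgraph :=
  SGraph expansion_edge_sym expansion_edge_irrefl expansion_vertex_gt0.

Lemma card_expansion : #|expansion| = #|outer| + (#|H| + 2 + n).+1 * 5.
Proof.
by rewrite card_sum card_prod !card_option !card_prod !card_sum card_bool card_ord.
Qed.

(** * Locating-dominating sets from the vertices of [H] *)

Definition cores_with (v : H) : {set expansion} :=
  [set x : expansion | match x with
                       | inl o => o == inl v
                       | inr (_, p) => (p == core true) || (p == core false)
                       end].

Lemma cores_with_core v j b : inr (j, core b) \in cores_with v.
Proof. by rewrite inE; case: b. Qed.

Lemma cores_with_outer u v : (inl (inl u) \in cores_with v) = (u == v).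
Proof. by rewrite inE. Qed.

Lemma locating_dominating_cores v : locating_dominating (cores_with v).
Proof.
have core_in := cores_with_core v.
apply/locating_dominatingP; split.
  case=> [o _|[j p]].
    exists (inr (None, core true)) => //.
    by case: o => [u|[b c]] /=; rewrite /attached !eqxx.
  case: p => [[b [|]]|] pS.
  - by exists (inr (j, core b)); rewrite //= !eqxx.
  - by rewrite core_in in pS.
  - by exists (inr (j, core true)); rewrite //= !eqxx.
have outer_edge o j p : @edge expansion (inl o) (inr (j, p)) = attached o j p.
  by case: o => [u|[b c]].
(* An outer vertex sees cores in two different paths, [None] and [Some (label o)]; a path vertex
   sees cores only in its own path. *)
have outer_ne o j p : ~ (forall s, s \in cores_with v ->
    @edge expansion (inl o) s = @edge expansion (inr (j, p)) s).
  move=> eqN.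
  have := eqN _ (core_in None true).
  have := eqN _ (core_in (Some (label o)) true).
  rewrite !outer_edge /attached !eqxx /= => /esym/andP[/eqP-> _].
  by [].
move=> [o|[j p]] [o'|[k q]] xS yS eqN; last 1 first.
(* Two path vertices are already separated by the cores of their own paths, which is a finite
   check. *)
- have N b := eqN _ (core_in j b); have N' b := eqN _ (core_in k b).
  have Nt := N true; have Nf := N false; have Nt' := N' true; have Nf' := N' false.
  move: xS yS Nt Nf Nt' Nf'; rewrite !inE /= !eqxx [k == j]eq_sym.
  by case: (j =P k) => [->|_]; case: p q {eqN N N'} => [[[] []]|] [[[] []]|].
- have := eqN _ (core_in (Some (label o)) true).
  rewrite !outer_edge /attached !eqxx /= => /esym/eqP[].
  (* Equal labels leave only the twins of one pair, and [v] is adjacent to exactly one of them. *)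
  have := eqN (inl (inl v)); rewrite inE eqxx => /(_ isT).
  case: o o' {xS yS eqN} => [u|[b c]] [u'|[b' c']] //=.
    by move=> _ [->].
  by move=> -> [->].
- by case: (outer_ne _ _ _ eqN).
- by case: (outer_ne o' j p) => s sS; rewrite eqN.
Qed.

(** * Lower bound and the case of equality *)

Definition gadget_count (S : {set expansion}) j : nat :=
  \sum_p (inr (j, p) \in S).
Definition outer_count (S : {set expansion}) : nat :=
  \sum_(o : outer) (inl o \in S).

Lemma card_expansion_set (S : {set expansion}) :
  #|S| = outer_count S + \sum_j gadget_count S j.
Proof.
rewrite -sum1_card big_mkcond big_sumType /outer_count /gadget_count pair_bigA /=.
congr (_ + _).
by apply: eq_bigr => -[j p] _.
Qed.

Lemma card_cores_with v : #|cores_with v| = (#|{: option label_type}| * 2).+1.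
Proof.
rewrite card_expansion_set /outer_count (bigD1 (inl v)) //= inE eqxx.
rewrite big1 => [|o /negPf neq_ov]; last by rewrite inE neq_ov.
rewrite addn0 -sum_nat_const; congr _.+1; apply: eq_bigr => j _.
by rewrite /gadget_count big_p5 !inE.
Qed.

Section LocatingDominatingSet.
Variable S : {set expansion}.
Hypothesis ldS : locating_dominating S.

(* Only the leaves and the middle vertex are used: they have no neighbour
   outside the path. *)
Lemma gadget_count_leqif j :
  2 <= gadget_count S j ?= iff
    [forall p : p5, (inr (j, p) \in S) == (p == core true) || (p == core false)].
Proof.
have /locating_dominatingP[domS locS] := ldS.
have leaf_dom b : (inr (j, Some (b, true)) \in S) || (inr (j, core b) \in S).
  apply/orP; have [|/domS[]] := boolP (_ \in S); first by left.
  case=> [o|[k q]] sS; first by case: o sS => [u|[b' c]] _ /andP[/eqP].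
  move=> /= /andP[/eqP jk]; rewrite -jk in sS.
  by case: q sS => [[c [|]]|] //= cS /andP[/eqP bc] // _; right; rewrite bc.
have mid_dom : [|| inr (j, None) \in S, inr (j, core true) \in S
                 | inr (j, core false) \in S].
  have [//|/domS[]] := boolP (inr (j, None) \in S).
  case=> [o|[k q]] sS; first by case: o sS => [u|[b' c]] _ /andP[/eqP].
  move=> /= /andP[/eqP jk]; rewrite -jk in sS.
  by case: q sS => [[[] []]|] //= ->; rewrite ?orbT.
(* Otherwise the leaf on side [b] and the middle vertex could both have only [core b] as a neighbour
   in [S]. *)
have leaf_mid b : [|| inr (j, None) \in S, inr (j, Some (b, true)) \in S
                    | inr (j, core (~~ b)) \in S].
  apply/negPn; rewrite !negb_or; apply/negP => /and3P[mS lS cS].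
  suff: inr (j, None) = inr (j, Some (b, true)) :> expansion by [].
  apply: (locS _ _ mS lS) => -[o|[k q]] sS.
    by case: o sS => [u|[b' c]] _; case: (b).
  rewrite /=; have [jk|//] := eqVneq j k; rewrite -jk in sS.
  case: q sS => [[c [|]]|] //= sS; first by rewrite andbF.
  rewrite andbT; have [//|neq_bc] := eqVneq b c.
  by case/negP: cS; case: b c neq_bc sS {lS} => [] [].
have := leaf_mid true; have := leaf_mid false.
have := leaf_dom true; have := leaf_dom false; move: mid_dom.
rewrite /gadget_count big_p5.
have -> : [forall p : p5, (inr (j, p) \in S) == (p == core true) || (p == core false)]
   = [&& inr (j, None) \notin S, inr (j, Some (true, true)) \notin S,
      inr (j, core true) \in S, inr (j, Some (false, true)) \notin S
      & inr (j, core false) \in S].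
  apply/forallP/and5P => [eqS|[/negPf ? /negPf ? ? /negPf ? ?]].
    by split; rewrite (eqP (eqS _)).
  by case=> [[[] []]|]; apply/eqP.
rewrite /=.
(* Everything is now a statement about five membership bits. *)
by do 5! case: (_ \in S).
Qed.

(** The twins have the same neighbours in the paths, so only a twin of this pair or a vertex of [H]
    can separate them. *)
Lemma outer_pair_hit b :
  exists2 o : outer, inl o \in S & if o is inr (b', _) then b' = b else true.
Proof.
have /locating_dominatingP[_ locS] := ldS.
have [lS|lS] := boolP (inl (inr (b, false)) \in S).
  by exists (inr (b, false)).
have [rS|rS] := boolP (inl (inr (b, true)) \in S); first by exists (inr (b, true)).
have [/existsP[u uS]|noS] := boolP [exists u, inl (inl u) \in S].
  by exists (inl u).
suff: inl (inr (b, false)) = inl (inr (b, true)) :> expansion by [].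
apply: locS => // -[[u|[]]|[]] //= uS.
by case/negP: noS; apply/existsP; exists u.
Qed.

Lemma outer_count_gt0 : 0 < outer_count S.
Proof.
have [o oS _] := outer_pair_hit true.
by rewrite /outer_count (bigD1 o) //= oS.
Qed.

Lemma locating_dominating_card_ge : (#|{: option label_type}| * 2).+1 <= #|S|.
Proof.
rewrite card_expansion_set -sum_nat_const -add1n leq_add ?outer_count_gt0 //.
by apply: leq_sum => j _; apply: (gadget_count_leqif j).
Qed.

(** All the lower bounds are tight. The single outer vertex must therefore serve both pairs of
    twins, which puts it in [H]. *)
Lemma locating_dominating_card_min :
  #|S| = (#|{: option label_type}| * 2).+1 -> exists v, S = cores_with v.
Proof.
have [le_gS eq_gS] := leqif_sum (fun j (_ : true) => gadget_count_leqif j).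
rewrite card_expansion_set -sum_nat_const => eqS.
have eq_sum : \sum_(j : option label_type) 2 = \sum_j gadget_count S j.
  apply/eqP; rewrite eqn_leq le_gS -ltnS -eqS -add1n leq_add2r.
  exact: outer_count_gt0.
have count1 : outer_count S = 1.
  by apply/eqP; rewrite -(eqn_add2r (\sum_j gadget_count S j)) eqS eq_sum.
have /forallP coresS : [forall j, [forall p : p5,
    (inr (j, p) \in S) == (p == core true) || (p == core false)]].
  by rewrite -eq_gS eq_sum.
have uniqS o o' : inl o \in S -> inl o' \in S -> o = o'.
  move=> oS o'S; apply/eqP; apply/negPn/negP => neq_oo'; move: count1.
  rewrite /outer_count (bigD1 o) //= oS (bigD1 o') /=; last by rewrite eq_sym.
  by rewrite o'S.
have [o oS o_true] := outer_pair_hit true.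
have [o' o'S o'_false] := outer_pair_hit false.
rewrite -(uniqS _ _ oS o'S) {o' o'S} in o'_false.
case: o => [v|[b c]] in oS o_true o'_false *; last by rewrite o_true in o'_false.
exists v; apply/setP => -[o|[j p]]; rewrite inE.
  by apply/idP/eqP => [o'S|->//]; apply: uniqS.
by have /forallP/(_ p)/eqP := coresS j.
Qed.

End LocatingDominatingSet.

(** * The isomorphism with [H] *)

Lemma gammaL_expansion (v : H) : gammaL expansion = #|cores_with v|.
Proof.
apply/eqP; rewrite eqn_leq gammaL_min ?locating_dominating_cores //=.
have [S ldS <-] := gammaL_attained expansion.
by rewrite card_cores_with locating_dominating_card_ge.
Qed.

Lemma gammaL_set_cores v : gammaL_set (cores_with v).
Proof. by rewrite /gammaL_set locating_dominating_cores (gammaL_expansion v) /=. Qed.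

Definition cores_vertex v : gammaL_graph expansion :=
  Sub (cores_with v) (gammaL_set_cores v).

Lemma cores_vertex_inj : injective cores_vertex.
Proof.
move=> u v /(congr1 val) /= /setP/(_ (inl (inl u))).
by rewrite !cores_with_outer eqxx => /esym/eqP.
Qed.

Lemma cores_vertex_surj (S : gammaL_graph expansion) :
  exists v, cores_vertex v == S.
Proof.
have /andP[ldS /eqP cS] := valP S.
(* The value of [gammaL] is known only through some vertex of [H], so nonemptiness enters here. *)
have /card_gt0P[w _] := vertex_gt0 H.
have [|v defS] := locating_dominating_card_min ldS.
  by rewrite cS (gammaL_expansion w) card_cores_with.
by exists v; apply/eqP/val_inj.
Qed.

(** The two sets share all cores, so a slide must bring in [v]; it must remove [u], which would
    otherwise stay in the second set. *)
Lemma cores_vertex_edge u v :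
  edge (cores_vertex u) (cores_vertex v) = edge u v.
Proof.
apply/idP/idP => [|euv]; last first.
  apply/exists_inP; exists (inl (inl u)); first by rewrite cores_with_outer.
  apply/exists_inP; exists (inl (inl v)); first by rewrite cores_with_outer.
  rewrite [edge _ _]euv; apply/eqP/setP => -[o|[j p]]; rewrite !inE.
    by rewrite !(inj_eq inl_inj); case: (o == inl u).
  by rewrite orbF.
case/exists_inP=> a aS /exists_inP[b bT /andP[eab /eqP defT]].
have bNS := gammaL_edge_notin aS eab defT.
have def_b : b = inl (inl v).
  move: bT bNS; rewrite !inE; case: b {eab defT} => [o /eqP->|[j p] ->] //.
have neq_uv : u != v by move: bNS; rewrite def_b cores_with_outer eq_sym.
suff def_a : a = inl (inl u) by rewrite def_a def_b in eab.
apply/esym/eqP/negPn/negP => neq_ua.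
have /setP/(_ (inl (inl u))) := defT.
by rewrite in_setU in_setD1 !cores_with_outer neq_ua eqxx (negPf neq_uv).
Qed.

Lemma gammaL_graph_expansion : graph_iso (gammaL_graph expansion) H.
Proof.
pose f S := xchoose (cores_vertex_surj S).
have fK : cancel f cores_vertex.
  by move=> S; apply/eqP/(xchooseP (cores_vertex_surj S)).
exists f; split=> [|S T]; last by rewrite -cores_vertex_edge !fK.
by exists cores_vertex => // v; apply: cores_vertex_inj; rewrite fK.
Qed.

End Construction.

Theorem theorem7 (H : sgraph) :
  exists G : nat -> sgraph,
    (forall i j : nat, i <> j -> ~ graph_iso (G i) (G j)) /\
    (forall i : nat, graph_iso (gammaL_graph (G i)) H).
Proof.
(* Each increment of the index adds one path of five vertices, so the orders differ. *)
exists (expansion H); split=> [i j neq_ij /graph_iso_card|i].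
  by rewrite !card_expansion => /addnI/eqP; rewrite eqn_pmul2r // eqSS eqn_add2l => /eqP.
exact: gammaL_graph_expansion.
Qed.
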